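(* Let $k$ be a commutative field and $\mathcal{A}$ an essentially small additive category. Let $A$ be an object of $\mathbf{Rep}(\mathcal{A})$ and $d\ge -1$ an integer. The functor $k[A]$ belongs to $\mathcal{F}_d(\mathcal{A};k)$ if and only if $\ell(A)\le d$.
   Context: $\mathbf{Rep}(\mathcal{A})$ is the abelian category of additive functors $\mathcal{A}\to\mathbf{Ab}$; $\mathcal{F}(\mathcal{A};k)$ is the abelian category of all (not necessarily additive) functors from $\mathcal{A}$ to $k$-vector spaces. Exactness is pointwise in both. For $A\in\mathbf{Rep}(\mathcal{A})$, $k[A]$ is the functor $x\mapsto k[A(x)]$ ($k$-linearization of sets). $\ell(A)$ is the length of $A$ in $\mathbf{Rep}(\mathcal{A})$, with $\ell(A)=\infty$ if $A$ is not of finite length. For $F\in\mathcal{F}(\mathcal{A};k)$ and $x\in\mathrm{Ob}\,\mathcal{A}$: $\tau_x(F)(a)=F(x\oplus a)$. The group $\mathcal{A}(x,a)$ acts on $F(x\oplus a)$ through $u\mapsto F\begin{pmatrix}\mathrm{Id}_x&0\\ u&\mathrm{Id}_a\end{pmatrix}$, and $\bar\tau_x(F)(a):=F(x\oplus a)_{\mathcal{A}(x,a)}$ (coinvariants), a quotient functor of $\tau_x(F)$. The canonical inclusions $a\to x\oplus a$ induce a natural morphism $F\to\bar\tau_x(F)$, whose cokernel is $\bar\delta_x(F)$. For $d\ge -1$, $\mathcal{F}_d(\mathcal{A};k)$ is the full subcategory of functors $F$ with $\bar\delta_{a_0}\cdots\bar\delta_{a_d}\tau_x(F)=0$ for all objects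 $a_0,\dots,a_d,x$ of $\mathcal{A}$ (for $d=-1$: $\tau_x(F)=0$ for all $x$). *)

(* Defs.v *)
From HB Require Import structures.
From mathcomp Require Import all_boot all_order all_algebra.
From mathcomp Require Import boolp classical_sets constructive_ereal.
From mathcomp Require Import freeg.

Set Implicit Arguments.
Unset Strict Implicit.
Unset Printing Implicit Defensive.

Import Order.TTheory GRing.Theory Num.Theory.

Local Open Scope ring_scope.
Local Open Scope quotient_scope.

(* The biproducts and the zero object are chosen; nothing below depends on the
   choice up to isomorphism. *)
Record additiveCategory := AdditiveCategory {
  Ob :> Type;
  Hom : Ob -> Ob -> zmodType;
  idm : forall a, Hom a a;
  compm : forall a b c, Hom b c -> Hom a b -> Hom a c;
  comp1m : forall a b (f : Hom a b), compm (idm b) f = f;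
  compm1 : forall a b (f : Hom a b), compm f (idm a) = f;
  compmA : forall a b c d (h : Hom c d) (g : Hom b c) (f : Hom a b),
    compm h (compm g f) = compm (compm h g) f;
  compmDl : forall a b c (g g' : Hom b c) (f : Hom a b),
    compm (g + g') f = compm g f + compm g' f;
  compmDr : forall a b c (g : Hom b c) (f f' : Hom a b),
    compm g (f + f') = compm g f + compm g f';
  zero_ob : Ob;
  from_zero : forall a (f : Hom zero_ob a), f = 0;
  to_zero : forall a (f : Hom a zero_ob), f = 0;
  osum : Ob -> Ob -> Ob;
  inj1 : forall a b, Hom a (osum a b);
  inj2 : forall a b, Hom b (osum a b);
  prj1 : forall a b, Hom (osum a b) a;
  prj2 : forall a b, Hom (osum a b) b;
  prj1_inj1 : forall a b, compm (prj1 a b) (inj1 a b) = idm a;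
  prj2_inj2 : forall a b, compm (prj2 a b) (inj2 a b) = idm b;
  prj1_inj2 : forall a b, compm (prj1 a b) (inj2 a b) = 0;
  prj2_inj1 : forall a b, compm (prj2 a b) (inj1 a b) = 0;
  osum_id : forall a b,
    compm (inj1 a b) (prj1 a b) + compm (inj2 a b) (prj2 a b)
    = idm (osum a b)
}.

Arguments Hom {_} _ _.
Arguments idm {_} a.
Arguments compm {_ a b c} _ _.
Arguments osum {_} _ _.
Arguments inj1 {_} a b.
Arguments inj2 {_} a b.
Arguments prj1 {_} a b.
Arguments prj2 {_} a b.

Declare Scope category_scope.
Delimit Scope category_scope with cat.

Notation "g \oc f" := (compm g f) (at level 40, left associativity).
Notation "a (+) b" := (osum a b)
  (at level 50, left associativity) : category_scope.

Local Open Scope category_scope.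

Definition isomorphic (A : additiveCategory) (a b : A) : Prop :=
  exists (f : Hom a b) (g : Hom b a), g \oc f = idm a /\ f \oc g = idm b.

(* The index type [I] lives in the universe of the carriers of MathComp
   structures, like the groups [Hom a b], whereas [Ob A] may be larger. *)
Definition essentially_small (A : additiveCategory) : Prop :=
  exists (I : choiceType) (s : I -> A), forall a, exists i, isomorphic a (s i).

Section SumMorphisms.
Context (A : additiveCategory).

Definition sum_map (x a b : A) (f : Hom a b) : Hom (x (+) a) (x (+) b) :=
  inj1 x b \oc prj1 x a + inj2 x b \oc f \oc prj2 x a.

(* The matrix [[Id_x, 0], [u, Id_a]]. *)
Definition shear (x a : A) (u : Hom x a) : Hom (x (+) a) (x (+) a) :=
  inj1 x a \oc prj1 x a + inj2 x a \oc u \oc prj1 x a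
  + inj2 x a \oc prj2 x a.

Lemma comp0m (a b c : A) (f : Hom a b) : (0 : Hom b c) \oc f = 0.
Proof. by apply: (addrI (0 \oc f)); rewrite -compmDl !addr0. Qed.

Lemma compm0 (a b c : A) (g : Hom b c) : g \oc (0 : Hom a b) = 0.
Proof. by apply: (addrI (g \oc 0)); rewrite -compmDr !addr0. Qed.

Lemma sum_map_inj2 (x a b : A) (f : Hom a b) :
  sum_map x f \oc inj2 x a = inj2 x b \oc f.
Proof.
by rewrite compmDl -!compmA prj1_inj2 prj2_inj2 compm0 add0r compm1.
Qed.

Lemma sum_map_id (x a : A) : sum_map x (idm a) = idm (x (+) a).
Proof. by rewrite /sum_map compm1 osum_id. Qed.

Lemma sum_map_comp (x a b c : A) (g : Hom b c) (f : Hom a b) :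
  sum_map x (g \oc f) = sum_map x g \oc sum_map x f.
Proof.
rewrite {3}/sum_map compmDr.
rewrite [sum_map x g \oc (inj1 x b \oc _)]compmA.
rewrite [sum_map x g \oc (_ \oc prj2 x a)]compmA.
rewrite [sum_map x g \oc (inj2 x b \oc f)]compmA sum_map_inj2.
rewrite {2}/sum_map compmDl -!(compmA _ _ (inj1 x b)).
by rewrite prj1_inj1 prj2_inj1 !compm0 addr0 compm1 /sum_map !compmA.
Qed.

Lemma sum_map_shear (x a b : A) (f : Hom a b) (u : Hom x a) :
  sum_map x f \oc shear u = shear (f \oc u) \oc sum_map x f.
Proof.
have I1 : sum_map x f \oc inj1 x a = inj1 x b.
  by rewrite compmDl -!compmA prj1_inj1 prj2_inj1 !compm0 addr0 compm1.
have P1 : prj1 x b \oc sum_map x f = prj1 x a.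
  by rewrite compmDr !compmA prj1_inj1 prj1_inj2 !comp0m addr0 comp1m.
have P2 : prj2 x b \oc sum_map x f = f \oc prj2 x a.
  by rewrite compmDr !compmA prj2_inj1 prj2_inj2 !comp0m add0r comp1m.
rewrite {1}/shear !(compmDr (sum_map x f)) /shear !(compmDl _ _ (sum_map x f)).
rewrite -!(compmA _ _ (sum_map x f)) P1 P2 !compmA.
by rewrite I1 !sum_map_inj2.
Qed.

End SumMorphisms.

Record addFunctor (A : additiveCategory) := AddFunctor {
  aobj :> A -> zmodType;
  amap : forall a b, Hom a b -> aobj a -> aobj b;
  amapB : forall a b (f : Hom a b), zmod_morphism (amap f);
  amap1 : forall a m, amap (idm a) m = m;
  amapM : forall a b c (g : Hom b c) (f : Hom a b) m,
    amap (g \oc f) m = amap g (amap f m);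
  amapD : forall a b (f g : Hom a b) m, amap (f + g) m = amap f m + amap g m
}.

Arguments amap {A} M {a b} f : rename.

HB.instance Definition _ (A : additiveCategory) (M : addFunctor A)
  (a b : A) (f : Hom a b) :=
  GRing.isZmodMorphism.Build (M a) (M b) (amap M f) (@amapB A M a b f).

Record addNat (A : additiveCategory) (M N : addFunctor A) := AddNat {
  acomp :> forall a, M a -> N a;
  acompB : forall a, zmod_morphism (@acomp a);
  acomp_nat : forall a b (f : Hom a b) m,
    acomp (amap M f m) = amap N f (acomp m)
}.

Arguments acomp {A M N} t a m : rename.

HB.instance Definition _ (A : additiveCategory) (M N : addFunctor A)
  (t : addNat M N) (a : A) :=
  GRing.isZmodMorphism.Build (M a) (N a) (t a) (@acompB A M N t a).

Section Length.
Context (A : additiveCategory).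
Implicit Types M N : addFunctor A.

Definition amono M N (i : addNat M N) : Prop := forall a, injective (i a).

Definition aepi M N (p : addNat M N) : Prop :=
  forall a (n : N a), exists m, p a m = n.

Definition azero M : Prop := forall a (m : M a), m = 0.

Definition asimple M : Prop :=
  ~ azero M /\
  forall N (i : addNat N M), amono i -> azero N \/ aepi i.

Definition short_exact M' M M'' (i : addNat M' M) (p : addNat M M'') : Prop :=
  [/\ amono i, aepi p
    & forall a (m : M a), p a m = 0 <-> exists m', i a m' = m].

(* A filtration 0 = M_0 < M_1 < ... < M_n = M with simple subquotients; in the
   second constructor [M'] is M_n and [M''] is M_(n+1) / M_n, for M = M_(n+1). *)
Inductive composition_length : addFunctor A -> nat -> Prop :=
| CompositionLength0 M : azero M -> composition_length M 0
| CompositionLengthS M' M M'' (i : addNat M' M) (p : addNat M M'') n :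
    composition_length M' n -> short_exact i p -> asimple M'' ->
    composition_length M n.+1.

(* By the Jordan-Holder theorem the value of [get] is the only possible one. *)
Definition ell M : \bar int :=
  if `[< exists n, composition_length M n >]
  then ((get [set n | composition_length M n]%classic)%:Z)%:E
  else +oo%E.

End Length.

Section QuotientModule.
Context (k : pzRingType) (V : lmodType k) (W : submodClosed V).

(* [submodClosed V] does not inherit from [zmodClosed V]. *)
Definition zmod_of_submod : {pred V} := [pred v | v \in W].

Fact zmod_of_submod_closed : zmod_closed zmod_of_submod.
Proof.
have [W0 WD] := submodClosedP W; split=> [|u v uW vW]; first exact: W0.
by rewrite inE -scaleN1r addrC; apply: WD.
Qed.

HB.instance Definition _ :=
  GRing.isZmodClosed.Build V zmod_of_submod zmod_of_submod_closed.

Definition quotmod : Type := Quotient.quot zmod_of_submod.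

HB.instance Definition _ := GRing.Zmodule.on quotmod.
HB.instance Definition _ := EqQuotient.on quotmod.

Definition quotmod_pi (v : V) : quotmod := \pi_quotmod v.

Lemma quotmod_piP (v w : V) : quotmod_pi v = quotmod_pi w <-> v - w \in W.
Proof.
have E : (v - w \in W) = (quotmod_pi v == quotmod_pi w).
  exact: (Quotient.idealrBE zmod_of_submod v w).
by rewrite E; split=> [->|/eqP].
Qed.

Lemma quotmod_piK (q : quotmod) : quotmod_pi (repr q) = q.
Proof. exact: reprK. Qed.

Fact quotmod_pi_is_zmod_morphism : zmod_morphism quotmod_pi.
Proof. exact: raddfB. Qed.

Definition quotmod_scale (c : k) (q : quotmod) : quotmod :=
  quotmod_pi (c *: repr q).

Lemma quotmod_scaleE c v :
  quotmod_scale c (quotmod_pi v) = quotmod_pi (c *: v).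
Proof.
by apply/quotmod_piP; rewrite -scalerBr rpredZ //; apply/quotmod_piP/quotmod_piK.
Qed.

Fact quotmod_scaleA a b q :
  quotmod_scale a (quotmod_scale b q) = quotmod_scale (a * b) q.
Proof. by rewrite -[q]quotmod_piK !quotmod_scaleE scalerA. Qed.

Fact quotmod_scale1 : left_id 1 quotmod_scale.
Proof. by move=> q; rewrite -[q]quotmod_piK !quotmod_scaleE scale1r. Qed.

Let piD v w : quotmod_pi (v + w) = quotmod_pi v + quotmod_pi w.
Proof. exact: raddfD. Qed.

Fact quotmod_scaleDr : right_distributive quotmod_scale +%R.
Proof.
move=> c q r; rewrite -[q]quotmod_piK -[r]quotmod_piK -piD !quotmod_scaleE.
by rewrite scalerDr piD.
Qed.

Fact quotmod_scaleDl q : {morph quotmod_scale^~ q : a b / a + b}.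
Proof.
by move=> a b; rewrite /= -[q]quotmod_piK !quotmod_scaleE scalerDl piD.
Qed.

HB.instance Definition _ := GRing.Zmodule_isLmodule.Build k quotmod
  quotmod_scaleA quotmod_scale1 quotmod_scaleDr quotmod_scaleDl.

Fact quotmod_pi_is_linear : linear quotmod_pi.
Proof. by move=> c v w; rewrite piD -quotmod_scaleE. Qed.

HB.instance Definition _ :=
  GRing.isLinear.Build k V quotmod _ quotmod_pi quotmod_pi_is_linear.

End QuotientModule.

Section Submodules.
Context (k : pzRingType) (V : lmodType k).

Definition lin_span (S : V -> Prop) : {pred V} := [pred v |
  `[< exists s : seq (k * V), (forall p, p \in s -> S p.2) /\
        v = \sum_(p <- s) p.1 *: p.2 >]].

Fact lin_span_submod_closed S : submod_closed (lin_span S).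
Proof.
split=> [|c u v].
  by rewrite inE; exists [::]; split; rewrite ?big_nil.
rewrite !inE => -[s [sS ->]] [t [tS ->]].
exists ([seq (c * p.1, p.2) | p <- s] ++ t); split.
  by move=> p; rewrite mem_cat => /orP[/mapP[q /sS qS ->]|/tS].
rewrite big_cat big_map /= scaler_sumr; congr (_ + _).
by apply: eq_bigr => p _; rewrite scalerA.
Qed.

HB.instance Definition _ S :=
  GRing.isSubmodClosed.Build k V (lin_span S) (lin_span_submod_closed S).

Context (U : lmodType k) (f : {linear U -> V}).

Definition lin_image : {pred V} := [pred v | `[< exists u, f u = v >]].

Fact lin_image_submod_closed : submod_closed lin_image.
Proof.
split=> [|c u v]; first by rewrite inE; exists 0; rewrite linear0.
rewrite !inE => -[x <-] [y <-].
by exists (c *: x + y); rewrite linearP.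
Qed.

HB.instance Definition _ :=
  GRing.isSubmodClosed.Build k V lin_image lin_image_submod_closed.

End Submodules.

Record vectFunctor (A : additiveCategory) (k : fieldType) := VectFunctor {
  fobj :> A -> lmodType k;
  fmap : forall a b, Hom a b -> fobj a -> fobj b;
  fmap_linear : forall a b (f : Hom a b), linear (fmap f);
  fmap1 : forall a v, fmap (idm a) v = v;
  fmapM : forall a b c (g : Hom b c) (f : Hom a b) v,
    fmap (g \oc f) v = fmap g (fmap f v)
}.

Arguments fmap {A k} F {a b} f : rename.

HB.instance Definition _ (A : additiveCategory) (k : fieldType)
  (F : vectFunctor A k) (a b : A) (f : Hom a b) :=
  GRing.isLinear.Build k (F a) (F b) _ (fmap F f) (@fmap_linear A k F a b f).

Record vectNat (A : additiveCategory) (k : fieldType)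
    (F G : vectFunctor A k) := VectNat {
  fcomp :> forall a, F a -> G a;
  fcomp_linear : forall a, linear (@fcomp a);
  fcomp_nat : forall a b (f : Hom a b) v,
    fcomp (fmap F f v) = fmap G f (fcomp v)
}.

Arguments fcomp {A k F G} t a v : rename.

HB.instance Definition _ (A : additiveCategory) (k : fieldType)
  (F G : vectFunctor A k) (t : vectNat F G) (a : A) :=
  GRing.isLinear.Build k (F a) (G a) _ (t a) (@fcomp_linear A k F G t a).

Definition fzero (A : additiveCategory) (k : fieldType)
  (F : vectFunctor A k) : Prop := forall a (v : F a), v = 0.

Section QuotientFunctor.
Context (A : additiveCategory) (k : fieldType) (F : vectFunctor A k).
Context (W : forall a, submodClosed (F a)).
Context (W_stable :
  forall a b (f : Hom a b) v, v \in W a -> fmap F f v \in W b).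

Definition quotF_map a b (f : Hom a b) (q : quotmod (W a)) : quotmod (W b) :=
  quotmod_pi (W b) (fmap F f (repr q)).

Lemma quotF_mapE a b (f : Hom a b) v :
  quotF_map f (quotmod_pi (W a) v) = quotmod_pi (W b) (fmap F f v).
Proof.
apply/quotmod_piP; rewrite -linearB; apply: W_stable.
exact/quotmod_piP/quotmod_piK.
Qed.

Fact quotF_map_linear a b (f : Hom a b) : linear (quotF_map f).
Proof.
move=> c q r; rewrite -[q]quotmod_piK -[r]quotmod_piK.
by rewrite -linearP !quotF_mapE !linearP.
Qed.

Fact quotF_map1 a q : quotF_map (idm a) q = q.
Proof. by rewrite -[q]quotmod_piK quotF_mapE fmap1. Qed.

Fact quotF_mapM a b c (g : Hom b c) (f : Hom a b) q :
  quotF_map (g \oc f) q = quotF_map g (quotF_map f q).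
Proof. by rewrite -[q]quotmod_piK !quotF_mapE fmapM. Qed.

Definition quotF : vectFunctor A k :=
  VectFunctor quotF_map_linear quotF_map1 quotF_mapM.

End QuotientFunctor.

Section Cokernel.
Context (A : additiveCategory) (k : fieldType) (F G : vectFunctor A k).
Context (t : vectNat F G).

Fact image_stable a b (f : Hom a b) v :
  v \in lin_image (t a) -> fmap G f v \in lin_image (t b).
Proof.
rewrite !inE => -[u <-].
by exists (fmap F f u); exact: fcomp_nat.
Qed.

Definition cokernel : vectFunctor A k :=
  @quotF A k G (fun a => lin_image (t a)) image_stable.

End Cokernel.

Section TauDelta.
Context (A : additiveCategory) (k : fieldType).
Implicit Types (F : vectFunctor A k) (x a : A).

Section Tau.
Context (x : A) (F : vectFunctor A k).

Definition tau_map a b (f : Hom a b) : F (x (+) a) -> F (x (+) b) :=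
  fmap F (sum_map x f).

Fact tau_map_linear a b (f : Hom a b) : linear (tau_map f).
Proof. exact: fmap_linear. Qed.

Fact tau_map1 a v : tau_map (idm a) v = v.
Proof. by rewrite /tau_map sum_map_id fmap1. Qed.

Fact tau_mapM a b c (g : Hom b c) (f : Hom a b) v :
  tau_map (g \oc f) v = tau_map g (tau_map f v).
Proof. by rewrite /tau_map sum_map_comp fmapM. Qed.

Definition tau : vectFunctor A k :=
  @VectFunctor A k (fun a => F (x (+) a)) _ tau_map_linear tau_map1 tau_mapM.

Definition coinv_rel a (w : tau a) : Prop :=
  exists (u : Hom x a) (v : F (x (+) a)), w = fmap F (shear u) v - v.

Fact coinv_rel_stable a b (f : Hom a b) w :
  w \in lin_span (@coinv_rel a) -> fmap tau f w \in lin_span (@coinv_rel b).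
Proof.
rewrite !inE => -[s [sS ->]].
exists [seq (p.1, fmap tau f p.2) | p <- s]; split; last first.
  by rewrite big_map linear_sum; apply: eq_bigr => p _; rewrite linearZ.
move=> _ /mapP[p /sS[u [v ->]] ->]; exists (f \oc u), (fmap tau f v).
by rewrite linearB /= /tau_map -!fmapM sum_map_shear.
Qed.

Definition bar_tau : vectFunctor A k :=
  @quotF A k tau (fun a => lin_span (@coinv_rel a)) coinv_rel_stable.

Definition to_bar_tau_fun a (v : F a) : bar_tau a :=
  quotmod_pi (lin_span (@coinv_rel a)) (fmap F (inj2 x a) v).

Fact to_bar_tau_linear a : linear (@to_bar_tau_fun a).
Proof. by move=> c v w; rewrite /to_bar_tau_fun !linearP. Qed.

Fact to_bar_tau_nat a b (f : Hom a b) v :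
  to_bar_tau_fun (fmap F f v) = fmap bar_tau f (to_bar_tau_fun v).
Proof.
rewrite [RHS]quotF_mapE; last exact: coinv_rel_stable.
by rewrite /= /tau_map -fmapM sum_map_inj2 fmapM.
Qed.

Definition to_bar_tau : vectNat F bar_tau :=
  VectNat to_bar_tau_linear to_bar_tau_nat.

Definition bar_delta : vectFunctor A k := cokernel to_bar_tau.

End Tau.

(* [s] is the sequence a_0, ..., a_d, which is empty for d = -1. *)
Definition in_Fd (d : int) F : Prop :=
  forall (x : A) (s : seq A), (size s)%:Z = d + 1 ->
    fzero (foldr bar_delta (tau x F) s).

End TauDelta.

Section FreeModule.
Context (k : fieldType).

Lemma scale_freegU (S : choiceType) (c b : k) (x : S) :
  c *: << b *g x >> = << c * b *g x >> :> {freeg S / k}.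
Proof. by apply/eqP/freeg_eqP => y; rewrite coeffZ !coeffU mulrA. Qed.

Lemma linear_fun_sum (U V : lmodType k) (h : U -> V) (hL : linear h)
    (I : Type) (r : seq I) (E : I -> U) :
  h (\sum_(i <- r) E i) = \sum_(i <- r) h (E i).
Proof.
have h0 : h 0 = 0.
  by have := hL (-1) 0 0; rewrite scaler0 addr0 scaleN1r addNr.
apply: (big_morph h) => // u v.
by have := hL 1 u v; rewrite !scale1r.
Qed.

Lemma fglift_linear (S : choiceType) (V : lmodType k) (h : S -> V) :
  linear (fglift h : {freeg S / k} -> V).
Proof.
have hB := lift_is_additive h.
have h0 : fglift h 0 = 0 by rewrite -(subrr 0) hB subrr.
have hN u : fglift h (- u) = - fglift h u by rewrite -sub0r hB h0 sub0r.
have hD u v : fglift h (u + v) = fglift h u + fglift h v.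
  by rewrite -{1}[v]opprK hB hN opprK.
move=> c u v; rewrite hD; congr (_ + _).
rewrite -[u]freeg_sumE scaler_sumr !(big_morph (fglift h) hD h0) scaler_sumr.
apply: eq_bigr => x _.
by rewrite scale_freegU [LHS]liftU [fglift _ _ in RHS]liftU scalerA.
Qed.

End FreeModule.

Section Linearization.
Context (A : additiveCategory) (k : fieldType) (M : addFunctor A).

Definition klin_map a b (f : Hom a b) :
    {freeg (M a) / k} -> {freeg (M b) / k} :=
  fglift (fun m : M a => << amap M f m >> : {freeg (M b) / k}).

Fact klin_map_linear a b (f : Hom a b) : linear (klin_map f).
Proof. exact: fglift_linear. Qed.

Lemma klin_mapU a b (f : Hom a b) c m :
  klin_map f << c *g m >> = << c *g amap M f m >>.
Proof. by rewrite /klin_map liftU scale_freegU mulr1. Qed.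

Fact klin_map1 a v : klin_map (idm a) v = v.
Proof.
rewrite -[v in RHS]freeg_sumE -[in LHS](freeg_sumE v).
rewrite (linear_fun_sum (@klin_map_linear _ _ _)).
by apply: eq_bigr => m _; rewrite klin_mapU amap1.
Qed.

Fact klin_mapM a b c (g : Hom b c) (f : Hom a b) v :
  klin_map (g \oc f) v = klin_map g (klin_map f v).
Proof.
rewrite -(freeg_sumE v) !(linear_fun_sum (@klin_map_linear _ _ _)).
by apply: eq_bigr => m _; rewrite !klin_mapU amapM.
Qed.

(* [{freeg S / k}] is the free k-module on the set S. *)
Definition klin : vectFunctor A k :=
  VectFunctor klin_map_linear klin_map1 klin_mapM.

End Linearization.

(* Main.v *)
(** The orbits of [Hom x a] on [M x * M a] show that [bar_delta x] sends
    [k[M/S]] to the direct sum, over the nonzero elements [m] of [(M/S) x], of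
    the [k[M/(S + <m>)]].  Iterating, the functor defining [F_d] vanishes on [k[M]]
    if and only if [M] has no strict chain of [d + 1] inclusions of subfunctors
    starting from 0, that is, if and only if the length of [M] is at most [d].

    Only right exactness is needed, so these decompositions are never built.
    One direction propagates generation of a functor by natural images of
    quotients [M/S]; the other propagates linear functionals exhibiting
    [k[M/S]] as a quotient.  Quotients are encoded by [S]-invariance. *)

From HB Require Import structures.
From mathcomp Require Import all_boot all_order all_algebra.
From mathcomp Require Import boolp classical_sets constructive_ereal.
From mathcomp Require Import freeg.
Require Import Defs.

Set Implicit Arguments.
Unset Strict Implicit.
Unset Printing Implicit Defensive.

Import Order.TTheory GRing.Theory Num.Theory.

Local Open Scope ring_scope.
Local Open Scope quotient_scope.
Local Open Scope category_scope.

#[local] Obligation Tactic := idtac.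

(** * Subfunctors of an additive functor and strict chains of them *)

Record subfunctor (A : additiveCategory) (M : addFunctor A) := Subfunctor {
  smem :> forall a, M a -> Prop;
  smem0 : forall a, smem (0 : M a);
  smemB : forall a (m n : M a), smem m -> smem n -> smem (m - n);
  smem_amap : forall a b (f : Hom a b) m, smem m -> smem (amap M f m)
}.

Section SubfunctorTheory.
Context (A : additiveCategory).
Implicit Types (M N : addFunctor A).

Lemma smemN M (S : subfunctor M) a (m : M a) : S a m -> S a (- m).
Proof. by move=> Sm; rewrite -sub0r; apply: smemB => //; apply: smem0. Qed.

Lemma smemD M (S : subfunctor M) a (m n : M a) : S a m -> S a n -> S a (m + n).
Proof. by move=> Sm Sn; rewrite -[n]opprK; apply/smemB/smemN. Qed.

Lemma smemBDl M (S : subfunctor M) a (m n : M a) :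
  S a (m - n) -> S a n -> S a m.
Proof. by move=> Smn Sn; rewrite -(subrK n m); apply: smemD. Qed.

Lemma smem_subl M (S : subfunctor M) a (m n p : M a) :
  S a (m - n) -> S a (m - p) <-> S a (n - p).
Proof.
move=> Smn; split=> h.
  have -> : n - p = (m - p) - (m - n) by rewrite opprB [RHS]addrC subrKA.
  exact: smemB.
by rewrite -(subrKA n); apply: smemD.
Qed.

Definition ssub M (S T : subfunctor M) : Prop := forall a m, S a m -> T a m.

(** The recursion peels off the lowest inclusion, the one consumed by a single [bar_delta]; the top
    of the chain need not be all of [M]. *)
Fixpoint has_chain M (S : subfunctor M) (n : nat) : Prop :=
  if n is n'.+1 then
    exists T : subfunctor M,
      [/\ ssub S T, exists a (m : M a), T a m /\ ~ S a m & has_chain T n']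
  else True.

Lemma has_chain_sub M (S T : subfunctor M) n :
  ssub S T -> has_chain T n -> has_chain S n.
Proof.
case: n => [|n] // ST [U [TU [a [m [Um nTm]]] Un]].
exists U; split=> //; first by move=> b p /ST /TU.
by exists a, m; split=> // /ST.
Qed.

Lemma has_chain_leq M (S : subfunctor M) n p :
  (n <= p)%N -> has_chain S p -> has_chain S n.
Proof.
elim: n p S => [|n IHn] [|p] S //= np [T [ST neq Tp]].
by exists T; split=> //; apply: IHn Tp.
Qed.

Program Definition szero M : subfunctor M :=
  @Subfunctor A M (fun a m => m = 0) _ _ _.
Next Obligation. by []. Qed.
Next Obligation. by move=> M a m n /= -> ->; rewrite subrr. Qed.
Next Obligation. by move=> M a b f m /= ->; rewrite raddf0. Qed.

Lemma szero_sub M (S : subfunctor M) : ssub (szero M) S.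
Proof. by move=> a m ->; apply: smem0. Qed.

Definition sfull M : subfunctor M :=
  @Subfunctor A M (fun _ _ => True) (fun _ => I) (fun _ _ _ _ _ => I)
    (fun _ _ _ _ _ => I).

Program Definition spreim M N (t : addNat M N) (S : subfunctor N) :
  subfunctor M := @Subfunctor A M (fun a m => S a (t a m)) _ _ _.
Next Obligation. by move=> M N t S a /=; rewrite raddf0; apply: smem0. Qed.
Next Obligation. by move=> M N t S a m n /=; rewrite raddfB; apply: smemB. Qed.
Next Obligation.
by move=> M N t S a b f m /=; rewrite acomp_nat; apply: smem_amap.
Qed.

Program Definition simage M N (t : addNat M N) (S : subfunctor M) :
  subfunctor N :=
  @Subfunctor A N (fun a n => exists2 m, S a m & t a m = n) _ _ _.
Next Obligation.
by move=> M N t S a /=; exists 0; rewrite ?raddf0 //; apply: smem0.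
Qed.
Next Obligation.
move=> M N t S a _ _ /= [m Sm <-] [n Sn <-].
by exists (m - n); rewrite ?raddfB //; apply: smemB.
Qed.
Next Obligation.
move=> M N t S a b f _ /= [m Sm <-].
by exists (amap M f m); rewrite ?acomp_nat //; apply: smem_amap.
Qed.

Lemma amap_subl M a b (f g : Hom a b) (m : M a) :
  amap M (f - g) m = amap M f m - amap M g m.
Proof. by apply/eqP; rewrite eq_sym subr_eq -amapD subrK. Qed.

Lemma amap_0l M a b (m : M a) : amap M (0 : Hom a b) m = 0.
Proof. by rewrite -(subrr (0 : Hom a b)) amap_subl subrr. Qed.

(** The subfunctor generated by [S] and [m]: since [M] is additive, the elements [amap M u m]
    already form a subgroup. *)
Program Definition sadjoin M (S : subfunctor M) x (m : M x) : subfunctor M :=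
  @Subfunctor A M (fun a n => exists u : Hom x a, S a (n - amap M u m)) _ _ _.
Next Obligation.
by move=> M S x m a /=; exists 0; rewrite amap_0l subrr; apply: smem0.
Qed.
Next Obligation.
move=> M S x m a n p /= [u Sn] [v Sp]; exists (u - v).
by rewrite amap_subl opprD addrACA -opprD; apply: smemB.
Qed.
Next Obligation.
move=> M S x m a b f n /= [u Sn]; exists (f \oc u).
by rewrite amapM -raddfB; apply: smem_amap.
Qed.

Lemma sadjoin_sub M (S : subfunctor M) x (m : M x) : ssub S (sadjoin S m).
Proof. by move=> a n Sn; exists 0; rewrite amap_0l subr0. Qed.

Lemma mem_sadjoin M (S : subfunctor M) x (m : M x) : sadjoin S m x m.
Proof. by exists (idm x); rewrite amap1 subrr; apply: smem0. Qed.

End SubfunctorTheory.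

(** * Subfunctors and quotients as additive functors *)

Section SubQuotient.
Context (A : additiveCategory) (M : addFunctor A) (S : subfunctor M).

Definition smem_pred a : {pred M a} := [pred m | `[< S a m >]].

Fact smem_pred_closed a : zmod_closed (@smem_pred a).
Proof.
split=> [|m n]; rewrite !inE; first exact: smem0.
exact: smemB.
Qed.

HB.instance Definition _ a :=
  GRing.isZmodClosed.Build (M a) (@smem_pred a) (@smem_pred_closed a).

Definition sub_obj a : Type := {m : M a | smem_pred m}.

HB.instance Definition _ a := SubChoice.on (sub_obj a).
HB.instance Definition _ a := [SubChoice_isSubZmodule of sub_obj a by <:].

Fact sub_amap_subproof a b (f : Hom a b) (m : sub_obj a) :
  smem_pred (amap M f (val m)).
Proof. by apply/asboolP; apply: smem_amap; apply/asboolP/(valP m). Qed.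

Definition sub_amap a b (f : Hom a b) (m : sub_obj a) : sub_obj b :=
  exist (fun n => smem_pred n) _ (sub_amap_subproof f m).

Program Definition subF : addFunctor A :=
  @AddFunctor A (fun a => sub_obj a) sub_amap _ _ _ _.
Next Obligation. by move=> a b f m n; apply: val_inj; rewrite /= raddfB. Qed.
Next Obligation. by move=> a m; apply: val_inj; rewrite /= amap1. Qed.
Next Obligation. by move=> a b c g f m; apply: val_inj; rewrite /= amapM. Qed.
Next Obligation. by move=> a b f g m; apply: val_inj; rewrite /= amapD. Qed.

Program Definition sub_incl : addNat subF M :=
  @AddNat A subF M (fun a (m : sub_obj a) => val m) _ _.
Next Obligation. by []. Qed.
Next Obligation. by []. Qed.

Definition quo_obj a : Type := Quotient.quot (@smem_pred a).

HB.instance Definition _ a := GRing.Zmodule.on (quo_obj a).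
HB.instance Definition _ a := EqQuotient.on (quo_obj a).

Definition quo_pi a (m : M a) : quo_obj a := \pi_(quo_obj a) m.

Lemma quo_piB a : zmod_morphism (@quo_pi a).
Proof. exact: raddfB. Qed.

Lemma quo_piP a (m n : M a) : quo_pi m = quo_pi n <-> S a (m - n).
Proof.
have E : (m - n \in @smem_pred a) = (quo_pi m == quo_pi n).
  exact: (Quotient.idealrBE (@smem_pred a) m n).
split=> [/eqP|Smn]; first by rewrite -E => /asboolP.
by apply/eqP; rewrite -E; apply/asboolP.
Qed.

Lemma quo_piK a (q : quo_obj a) : quo_pi (repr q) = q.
Proof. exact: reprK. Qed.

Definition quo_amap a b (f : Hom a b) (q : quo_obj a) : quo_obj b :=
  quo_pi (amap M f (repr q)).

Lemma quo_amapE a b (f : Hom a b) m :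
  quo_amap f (quo_pi m) = quo_pi (amap M f m).
Proof.
by apply/quo_piP; rewrite -raddfB; apply/smem_amap/quo_piP; rewrite quo_piK.
Qed.

Program Definition quoF : addFunctor A :=
  @AddFunctor A (fun a => quo_obj a) quo_amap _ _ _ _.
Next Obligation.
move=> a b f q r; rewrite -[q]quo_piK -[r]quo_piK -quo_piB !quo_amapE.
by rewrite raddfB quo_piB.
Qed.
Next Obligation. by move=> a q; rewrite -[q]quo_piK quo_amapE amap1. Qed.
Next Obligation.
by move=> a b c g f q; rewrite -[q]quo_piK !quo_amapE amapM.
Qed.
Next Obligation.
move=> a b f g q; rewrite -[q]quo_piK !quo_amapE amapD.
exact: (raddfD (\pi_(quo_obj b))).
Qed.

Program Definition quo_proj : addNat M quoF :=
  @AddNat A M quoF quo_pi quo_piB _.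
Next Obligation. by move=> a b f m; rewrite /= quo_amapE. Qed.

Lemma quo_proj0 a (m : M a) : quo_proj a m = 0 <-> S a m.
Proof.
by rewrite -(raddf0 (quo_proj a)) -[m in S a m]subr0; apply: quo_piP.
Qed.

Lemma sub_quo_exact : short_exact sub_incl quo_proj.
Proof.
split=> [a m n|a q|a m]; first exact: val_inj.
  by exists (repr q); apply: quo_piK.
rewrite quo_proj0; split=> [Sm|[m' <-]]; last exact/asboolP/(valP m').
by exists (exist (fun n => smem_pred n) m (asboolT Sm)).
Qed.

End SubQuotient.

(** * Chains of subfunctors and composition length *)

Section CompositionLength.
Context (A : additiveCategory).
Implicit Types (M N : addFunctor A).

(** Injectivity of [i] keeps every step strict, and the proper subfunctor [T] bounds all the images,
    leaving room for a last step up to [M]. *)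
Lemma has_chain_simage M' M (i : addNat M' M) (T : subfunctor M) n
    (S : subfunctor M') :
  amono i -> ssub (simage i (sfull M')) T ->
  (exists a (m : M a), ~ T a m) -> has_chain S n ->
  has_chain (simage i S) n.+1.
Proof.
move=> imono iT [c [p nTp]]; elim: n S => [|n IHn] S /= => [_|].
  exists (sfull M); split=> //; exists c, p; split=> //.
  by case=> m _ mp; apply/nTp/iT; exists m.
case=> S' [SS' [a [m [S'm nSm]]] S'n].
exists (simage i S'); split; last exact: IHn.
  by move=> b _ [q Sq <-]; exists q => //; apply: SS'.
exists a, (i a m); split; first by exists m.
by case=> q Sq /imono qm; apply: nSm; rewrite -qm.
Qed.

Lemma composition_length_has_chain M n :
  composition_length M n -> has_chain (szero M) n.
Proof.
elim=> // M' {}M M'' i p {}n _ M'n [imono pepi ex] [nz _].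
apply: has_chain_sub (@szero_sub _ _ _) _.
(* The kernel of [p] is proper because [M''] is nonzero. *)
apply: (has_chain_simage (T := spreim p (szero M''))) M'n => //.
  by move=> a _ [m _ <-] /=; apply/ex; exists m.
apply: contrapT => h; apply: nz => a q; have [m <-] := pepi a q.
by apply: contrapT => pm; apply: h; exists a, m.
Qed.

Section Extension.
Context (M' M M'' : addFunctor A) (i : addNat M' M) (p : addNat M M'').
Hypotheses (ex : short_exact i p) (M''simple : asimple M'').

(** Given [m] in [T], pick [n] in [S] with the same image under [p]: then [m - n] comes from [M']
    and lies in [T], hence in [S]. *)
Lemma ssub_of_extension (S T : subfunctor M) : ssub S T ->
  ssub (spreim i T) (spreim i S) -> ssub (simage p T) (simage p S) -> ssub T S.
Proof.
case: ex => _ _ E ST iTS pTS a m Tm.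
have [|n Sn pnm] := pTS a (p a m); first by exists m.
have [m' im'] : exists m', i a m' = m - n.
  by apply/E; rewrite raddfB /= pnm subrr.
apply: (smemBDl _ Sn); rewrite -im'; apply: iTS.
by rewrite /= im'; apply: smemB => //; apply: ST.
Qed.

Lemma simage_full (S : subfunctor M) a m :
  S a m -> p a m <> 0 -> ssub (sfull M'') (simage p S).
Proof.
move=> Sm pm0; case: M''simple => _ /(_ _ (sub_incl (simage p S))) [].
- by move=> b q r; apply: val_inj.
- move=> z; case: pm0.
  have pS : simage p S a (p a m) by exists m.
  pose q := exist (fun n => smem_pred (simage p S) n) _ (asboolT pS).
  by have /(congr1 val) := z _ q.
- by move=> h b q _; have [r <-] := h b q; apply/asboolP/(valP r).
Qed.

(** When [S] already covers [M''], no step is strict there, so by [ssub_of_extension] every step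
    stays strict in [M']. *)
Lemma has_chain_spreim_full (S : subfunctor M) n :
  ssub (sfull M'') (simage p S) -> has_chain S n -> has_chain (spreim i S) n.
Proof.
elim: n S => [|n IHn] S //= pS [T [ST [a [m [Tm nSm]]] Tn]].
exists (spreim i T); split; first by move=> b q /ST.
  apply: contrapT => h; apply: nSm.
  apply: (ssub_of_extension ST) Tm => [b q iTq|b q _]; last exact: pS.
  by apply: contrapT => nS; apply: h; exists b, q.
by apply: IHn => // b q /pS [r Sr <-]; exists r => //; apply: ST.
Qed.

(* By [ssub_of_extension] every step of a chain is strict in [M'] or in [M''],
   and, [M''] being simple, at most one step is strict in [M'']. *)
Lemma has_chain_spreim (S : subfunctor M) n :
  has_chain S n.+1 -> has_chain (spreim i S) n.
Proof.
elim: n S => [|n IHn] S // [T [ST [a [m [Tm nSm]]] Tn]].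
have iST : ssub (spreim i S) (spreim i T) by move=> b q /ST.
have [pTS|] := pselect (ssub (simage p T) (simage p S)).
  exists (spreim i T); split=> //; last exact: IHn.
  apply: contrapT => h; apply: nSm.
  apply: (ssub_of_extension ST) Tm => // b q iTq.
  by apply: contrapT => nS; apply: h; exists b, q.
(* Here [simage p T] is nonzero, hence full by simplicity: the chain above [T] loses nothing in
   [M'], and only the step from [S] to [T] is given up. *)
move=> npTS; apply: has_chain_sub iST _.
apply: (@has_chain_spreim_full T n.+1 _ Tn).
have [//|h] := pselect (ssub (sfull M'') (simage p T)).
case: npTS => b _ [q Tq <-]; exists 0; first exact: smem0.
rewrite raddf0; apply: contrapT => pq; apply: h.
by apply: simage_full Tq _ => /esym.
Qed.

End Extension.

(** Each simple layer absorbs at most one step. The bottom [S] is arbitrary because the induction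
    replaces it by [spreim i S]. *)
Lemma composition_length_no_chain M n (S : subfunctor M) :
  composition_length M n -> ~ has_chain S n.+1.
Proof.
move=> Mn; elim: Mn S => [{}M M0|M' {}M M'' i p {}n _ IHn ex si] S.
  by case=> T [_ [a [m [_ nSm]]] _]; apply: nSm; rewrite (M0 a m); apply: smem0.
by move/(has_chain_spreim ex si); apply: IHn.
Qed.

Definition smaximal M (S : subfunctor M) : Prop :=
  (exists a (m : M a), ~ S a m) /\
  forall T : subfunctor M, ssub S T ->
    ssub T S \/ ssub (sfull M) T.

(** A proper [S] that is not maximal sits strictly below a proper [T], and the bound on chains drops
    by one above [T], so the ascent stops. *)
Lemma exists_smaximal M (S : subfunctor M) n :
  (exists a (m : M a), ~ S a m) -> ~ has_chain S n ->
  exists T : subfunctor M, smaximal T.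
Proof.
elim: n S => [|n IHn] S Sne Sn; first by case: Sn.
have [|nmax] := pselect (smaximal S); first by exists S.
apply: contrapT => nomax; apply: nmax; split=> // T ST.
apply: contrapT => /not_orP[nTS nT]; apply: nomax; apply: (IHn T).
  apply: contrapT => h; apply: nT => a m _.
  by apply: contrapT => nTm; apply: h; exists a, m.
move=> Tn; apply: Sn; exists T; split=> //.
apply: contrapT => h; apply: nTS => a m Tm.
by apply: contrapT => nSm; apply: h; exists a, m.
Qed.

Lemma asimple_quoF M (S : subfunctor M) : smaximal S -> asimple (quoF S).
Proof.
case=> -[a [m nSm]] Smax; split=> [z|N j jmono].
  by apply: nSm; apply/quo_proj0; apply: z.
(* By maximality, the preimage in [M] of the image of [N] is either [S] or everything. *)
pose T := spreim (quo_proj S) (simage j (sfull N)).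
have [b q /quo_proj0 Sq||] := Smax T.
- by exists 0 => //; rewrite raddf0; apply: esym.
- move=> TS; left=> b n; apply: jmono; rewrite raddf0.
  rewrite -[j b n](quo_piK (S := S)); apply/quo_proj0/TS.
  by exists n => //=; rewrite quo_piK.
- move=> Tfull; right=> b q.
  have [n _ jn] := Tfull b (repr q) I.
  by exists n; rewrite jn /= quo_piK.
Qed.

(** Split off a simple quotient [quoF S] with [S] maximal: by [has_chain_simage], a chain of [n]
    steps in [subF S] would give [n.+1] steps in [M]. *)
Lemma exists_composition_length M n :
  ~ has_chain (szero M) n -> exists p, composition_length M p.
Proof.
elim: n M => [|n IHn] M Mn; first by case: Mn.
have [M0|nz] := pselect (azero M); first by exists 0%N; constructor.
have [||S Smax] := @exists_smaximal M (szero M) n.+1 => //.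
  apply: contrapT => h; apply: nz => a m.
  by apply: contrapT => nm; apply: h; exists a, m.
have [imono _ _] := sub_quo_exact S.
have [p Sp] : exists p, composition_length (subF S) p.
  apply: IHn => Sn; apply: Mn; apply: has_chain_sub (@szero_sub _ _ _) _.
  apply: (has_chain_simage (T := S) imono _ _ Sn); last by case: Smax.
  by move=> a _ [m _ <-]; apply/asboolP/(valP m).
exists p.+1; apply: CompositionLengthS Sp (sub_quo_exact S) _.
exact: asimple_quoF.
Qed.

(** If [l] is a composition length, chains of [l] steps exist and chains of [l + 1] steps do not;
    [l <= d] reads [l < n]. For [d = -1] both sides are false. *)
Lemma ell_le M (d : int) (n : nat) : n%:Z = d + 1 ->
  (ell M <= d%:E)%E <-> ~ has_chain (szero M) n.
Proof.
move=> nd; rewrite /ell; case: asboolP => [exM|noM]; last first.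
  split=> // Mn; case: noM; exact: exists_composition_length Mn.
have := getPex exM; set l := get _ => /= Ml.
rewrite lee_fin -ltzD1 -nd ltz_nat; split=> [ln Mn|Mn].
  exact: (composition_length_no_chain Ml) (has_chain_leq ln Mn).
rewrite ltnNge; apply/negP => nl; apply: Mn.
exact: has_chain_leq nl (composition_length_has_chain Ml).
Qed.

End CompositionLength.

(** * Effect of [bar_delta] on linearizations *)

Section LinearSpan.
Context (k : pzRingType) (V : lmodType k).

Lemma mem_lin_span (P : V -> Prop) v : P v -> v \in lin_span P.
Proof.
move=> Pv; rewrite inE; exists [:: (1, v)]; rewrite big_seq1 scale1r.
by split=> // p; rewrite inE => /eqP ->.
Qed.

Lemma lin_span_ind (P Q : V -> Prop) : Q 0 ->
  (forall c u v, P u -> Q v -> Q (c *: u + v)) ->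
  forall v, v \in lin_span P -> Q v.
Proof.
move=> Q0 QP v; rewrite inE => -[s [sP ->]].
elim: s sP => [|p s IHs] sP; first by rewrite big_nil.
rewrite big_cons; apply: QP; first by apply: sP; rewrite mem_head.
by apply: IHs => q qs; apply: sP; rewrite inE qs orbT.
Qed.

End LinearSpan.

Section BarDelta.
Context (A : additiveCategory) (k : fieldType) (x : A) (F : vectFunctor A k).

(** The composite projection from [tau x F] through [bar_tau x F]. *)
Definition bar_delta_pi a (w : F (x (+) a)) : bar_delta x F a :=
  quotmod_pi (lin_image (to_bar_tau x F a))
    (quotmod_pi (lin_span (@coinv_rel A k x F a)) w).

Definition bar_delta_repr a (z : bar_delta x F a) : F (x (+) a) :=
  repr (repr z).

Lemma bar_delta_piK a (z : bar_delta x F a) :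
  bar_delta_pi (bar_delta_repr z) = z.
Proof. by rewrite /bar_delta_pi !quotmod_piK. Qed.

Lemma bar_delta_pi_linear a : linear (@bar_delta_pi a).
Proof. by move=> c u v; rewrite /bar_delta_pi !linearP. Qed.

Lemma bar_delta_pi_nat a b (f : Hom a b) w :
  fmap (bar_delta x F) f (bar_delta_pi w)
  = bar_delta_pi (fmap F (sum_map x f) w).
Proof.
rewrite [LHS]quotF_mapE; last exact: image_stable.
congr quotmod_pi; rewrite [LHS]quotF_mapE //; exact: coinv_rel_stable.
Qed.

Lemma bar_delta_pi_shear a (u : Hom x a) v :
  bar_delta_pi (fmap F (shear u) v) = bar_delta_pi v.
Proof.
congr quotmod_pi; apply/quotmod_piP.
by apply: mem_lin_span; exists u, v.
Qed.

Lemma bar_delta_pi_inj2 a v : bar_delta_pi (fmap F (inj2 x a) v) = 0.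
Proof.
rewrite -[RHS](linear0 (quotmod_pi (lin_image (to_bar_tau x F a)))).
by apply/quotmod_piP; rewrite subr0 inE; exists v.
Qed.

(** The universal property of [bar_delta]: [h] kills the coinvariant relations and the image of
    [F a], hence factors through [bar_delta_pi]. *)
Lemma bar_delta_pi_eq a (W : lmodType k) (h : F (x (+) a) -> W) :
  linear h ->
  (forall u v, h (fmap F (shear u) v) = h v) ->
  (forall v, h (fmap F (inj2 x a) v) = 0) ->
  forall w w', bar_delta_pi w = bar_delta_pi w' -> h w = h w'.
Proof.
move=> hL hS hI w w'.
have hB u v : h (u - v) = h u - h v.
  by rewrite addrC -scaleN1r hL scaleN1r addrC.
have h0 : h 0 = 0 by rewrite -(subrr 0) hB subrr.
have hspan v : v \in lin_span (@coinv_rel A k x F a) -> h v = 0.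
  move: v; apply: lin_span_ind => // c u v [g [p ->]] hv.
  by rewrite hL hv hB hS subrr scaler0 addr0.
have hpi p q : quotmod_pi (lin_span (@coinv_rel A k x F a)) p
             = quotmod_pi (lin_span (@coinv_rel A k x F a)) q -> h p = h q.
  by move/quotmod_piP/hspan; rewrite hB => /subr0_eq.
move/quotmod_piP; rewrite -linearB inE => -[v].
by move/hpi; rewrite hI hB => /esym/subr0_eq.
Qed.

End BarDelta.

(** * Vanishing: generation by natural images of [k[M/S]] *)

Section Spanned.
Context (A : additiveCategory) (k : fieldType) (M : addFunctor A).
Implicit Types (F : vectFunctor A k) (S : subfunctor M).

(* [b] is a natural map of sets that factors through [M / S]. *)
Definition quotient_nat S F (b : forall a, M a -> F a) : Prop :=
  (forall a c (f : Hom a c) m, fmap F f (b a m) = b c (amap M f m)) /\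
  (forall a (m n : M a), S a (m - n) -> b a m = b a n).

(** [F] is a sum of natural images of [k[M/S]] with [M/S] of length less than [n]; for [n = 0] no
    generator is available. *)
Definition spanned F n : Prop := forall a (v : F a),
  v \in lin_span (fun w : F a => exists S (b : forall a, M a -> F a) (m : M a),
    [/\ quotient_nat S b, ~ has_chain S n & w = b a m]).

Lemma spanned0 F : spanned F 0 -> fzero F.
Proof.
move=> F0 a v; have := F0 a v; move: v; apply: lin_span_ind => // c u v.
by case=> S [b [m [_ []]]].
Qed.

Lemma amap_sum_map x a c (f : Hom a c) (m : M x) (p : M a) :
  amap M (sum_map x f) (amap M (inj1 x a) m + amap M (inj2 x a) p)
  = amap M (inj1 x c) m + amap M (inj2 x c) (amap M f p).
Proof.
rewrite raddfD /= -!amapM sum_map_inj2 compmDl -!compmA prj1_inj1 prj2_inj1.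
by rewrite !compm0 addr0 compm1.
Qed.

Lemma amap_shear x a (u : Hom x a) (m : M x) (p : M a) :
  amap M (shear u) (amap M (inj1 x a) m + amap M (inj2 x a) p)
  = amap M (inj1 x a) m + amap M (inj2 x a) (amap M u m + p).
Proof.
rewrite !raddfD /= -!amapM !compmDl -!compmA prj1_inj1 prj2_inj1 prj1_inj2.
by rewrite prj2_inj2 !compm0 !compm1 !addr0 add0r amapD !addrA.
Qed.

Lemma amap_inj_prj x a (p : M (x (+) a)) :
  p = amap M (inj1 x a) (amap M (prj1 x a) p)
    + amap M (inj2 x a) (amap M (prj2 x a) p).
Proof. by rewrite -!amapM -amapD osum_id amap1. Qed.

(** Write a generator as [b] at a pair [(m, q)]. If [S] contains [m], it comes from [F a] and dies.
    Otherwise shears move [q] by [amap M u m], so its class depends only on [q] modulo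
    [sadjoin S m], a strictly larger subfunctor. *)
Lemma spanned_bar_delta x F n : spanned F n.+1 -> spanned (bar_delta x F) n.
Proof.
move=> Fn a z; rewrite -(bar_delta_piK z).
move: (bar_delta_repr z) (Fn _ (bar_delta_repr z)).
apply: lin_span_ind => [|c _ w [S [b [p [[bnat bS] Sn ->]]]] IHw].
  rewrite (_ : bar_delta_pi 0 = 0) ?rpred0 //.
  by rewrite -(linear0 (fmap F (inj2 x a))) bar_delta_pi_inj2.
rewrite bar_delta_pi_linear; apply: rpredD => //; apply: rpredZ.
rewrite (amap_inj_prj p); move: (amap M _ p) (amap M _ p) => q m.
have [Sm|nSm] := pselect (S x m).
  rewrite (bS _ _ (amap M (inj2 x a) q)) -?bnat ?bar_delta_pi_inj2 ?rpred0 //.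
  by rewrite addrK; apply: smem_amap.
apply: mem_lin_span; exists (sadjoin S m).
pose b' c (q : M c) :=
  bar_delta_pi (b _ (amap M (inj1 x c) m + amap M (inj2 x c) q)).
exists b', q; split=> //; last first.
  move=> Tn; apply: Sn; exists (sadjoin S m); split=> //.
    exact: sadjoin_sub.
  by exists x, m; split=> //; apply: mem_sadjoin.
split=> [d e f r|d r s [u Su]].
  by rewrite /b' bar_delta_pi_nat bnat amap_sum_map.
(* The shear by [u] turns the pair [(m, s)] into [(m, amap M u m + s)], which agrees with [(m, r)]
   modulo [S]. *)
rewrite /b' -[RHS](bar_delta_pi_shear u) bnat amap_shear; congr bar_delta_pi.
apply: bS; rewrite opprD addrACA subrr add0r -raddfB; apply: smem_amap.
by rewrite opprD addrA addrAC.
Qed.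

Lemma spanned_foldr F n (s : seq A) :
  spanned F (size s + n) -> spanned (foldr (@bar_delta A k) F s) n.
Proof.
elim: s n => [|x s IHs] n //= Fn; apply: spanned_bar_delta.
by apply: IHs; rewrite addnS.
Qed.

(** For a fixed component [m] in [M x], the basis vector of [(m, q)] is natural in [q], so these
    vectors generate by images of [k[M]]. *)
Lemma spanned_tau_klin x n :
  ~ has_chain (szero M) n -> spanned (tau x (klin k M)) n.
Proof.
move=> Mn a v; rewrite -[v]freeg_sumE; apply: rpred_sum => p _.
have -> : << coeff p v *g p >> = coeff p v *: << p >> :> klin k M (x (+) a).
  by rewrite scale_freegU mulr1.
apply: rpredZ; rewrite (amap_inj_prj p).
move: (amap M _ p) (amap M _ p) => q m; apply: mem_lin_span.
pose b c (q : M c) : tau x (klin k M) c :=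
  << amap M (inj1 x c) m + amap M (inj2 x c) q >>.
exists (szero M), b, q; split=> //; split=> [c d f r|c r s /subr0_eq -> //].
by rewrite /b /= /tau_map /= klin_mapU amap_sum_map.
Qed.

End Spanned.

(** * Nonvanishing: functionals that detect [k[M/S]] *)

Section Detected.
Context (A : additiveCategory) (k : fieldType) (M : addFunctor A).
Implicit Types (F : vectFunctor A k) (S T : subfunctor M).

Lemma prj1_sum_map (x a b : A) (f : Hom a b) :
  prj1 x b \oc sum_map x f = prj1 x a.
Proof.
by rewrite compmDr !compmA prj1_inj1 prj1_inj2 !comp0m addr0 comp1m.
Qed.

Lemma prj2_sum_map (x a b : A) (f : Hom a b) :
  prj2 x b \oc sum_map x f = f \oc prj2 x a.
Proof.
by rewrite compmDr !compmA prj2_inj1 prj2_inj2 !comp0m add0r comp1m.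
Qed.

Definition invariant_fun S a (phi : M a -> k) : Prop :=
  forall m n, S a (m - n) -> phi m = phi n.

(* [L] describes, by duality, a natural epimorphism [F -> k[M/S]]. *)
Definition detected F S : Prop :=
  exists L : forall a, (M a -> k) -> F a -> k,
  [/\ forall a v, L a (fun=> 0) v = 0,
      forall a phi, invariant_fun S phi -> linear (L a phi : F a -> k^o),
      forall a b (f : Hom a b) phi v, invariant_fun S phi ->
        L b phi (fmap F f v) = L a (phi \o amap M f) v
    & forall a m, exists v, forall phi, invariant_fun S phi ->
        L a phi v = phi m].

(** The functional of the constant function 1 takes the value 1 on a preimage of the element 0 of
    [M]. *)
Lemma detected_nonzero F S : detected F S -> ~ fzero F.
Proof.
case=> L [L0 Llin _ Lsurj] F0; have [v Lv] := Lsurj (zero_ob A) 0.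
have inv1 : invariant_fun S (fun _ : M (zero_ob A) => 1) by [].
have := Llin _ _ inv1 (-1) 0 0.
rewrite scaler0 addr0 scaleN1r addNr -(F0 _ v) Lv // => /eqP.
by rewrite oner_eq0.
Qed.

(* The functional of [phi] on [bar_delta x F] records those [p : M (x (+) a)]
   whose first component is [m0] modulo [S]. *)
Lemma detected_bar_delta x (m0 : M x) F S T :
  ssub S T -> T x m0 -> ~ S x m0 -> detected F S -> detected (bar_delta x F) T.
Proof.
move=> ST Tm0 nSm0 [L [L0 Llin Lnat Lsurj]].
pose psi a (phi : M a -> k) (p : M (x (+) a)) : k :=
  if `[< S x (amap M (prj1 x a) p - m0) >] then phi (amap M (prj2 x a) p)
  else 0.
have psiS a phi : invariant_fun T phi -> invariant_fun S (psi a phi).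
  move=> Tphi p q Spq; rewrite /psi.
  have -> : `[< S x (amap M (prj1 x a) p - m0) >]
          = `[< S x (amap M (prj1 x a) q - m0) >].
    apply/asbool_equiv_eq/smem_subl.
    by rewrite -raddfB; apply: smem_amap.
  case: ifP => // _; apply: Tphi; rewrite -raddfB.
  by apply/smem_amap/ST.
have psi_comp a b (f : Hom a b) phi :
    psi b phi \o amap M (sum_map x f) = psi a (phi \o amap M f).
  apply/funext => p; rewrite /psi /= -!amapM.
  by rewrite prj1_sum_map prj2_sum_map amapM.
have psi_shear a (u : Hom x a) phi : invariant_fun T phi ->
    psi a phi \o amap M (shear u) = psi a phi.
  move=> Tphi; apply/funext => p; rewrite /psi /=.
  rewrite {1 2}(amap_inj_prj p) amap_shear !raddfD /= -!amapM.
  rewrite ?compmA prj1_inj1 prj2_inj1 prj1_inj2 prj2_inj2.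
  rewrite !comp1m !comp0m !amap_0l !addr0 !add0r.
  (* The first component of [p] is congruent to [m0] modulo [S], hence lies in [T]; the shear thus
     moves the second component by an element of [T]. *)
  case: asboolP => // Sp; apply: Tphi; rewrite addrK amapM.
  by apply: smem_amap; apply: smemBDl Tm0; apply: ST.
(* The first component is 0 here, and it is not congruent to [m0] since [m0] lies outside [S]. *)
have psi_inj2 a phi : psi a phi \o amap M (inj2 x a) = fun=> 0.
  apply/funext => p; rewrite /psi /= -!amapM prj1_inj2 amap_0l sub0r.
  by case: asboolP => // /smemN; rewrite opprK.
pose L' a phi (z : bar_delta x F a) : k :=
  L (x (+) a) (psi a phi) (bar_delta_repr z).
have L'E a phi w : invariant_fun T phi ->
    L' a phi (bar_delta_pi w) = L (x (+) a) (psi a phi) w.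
  move=> Tphi; have Spsi := psiS _ _ Tphi.
  apply: (bar_delta_pi_eq (Llin _ _ Spsi)); last exact: bar_delta_piK.
    by move=> u v; rewrite Lnat // psi_shear.
  by move=> v; rewrite Lnat // psi_inj2 L0.
exists L'; split=> [a z|a phi Tphi c z z'|a b f phi z Tphi|a m].
- rewrite /L' (_ : psi a _ = fun=> 0) ?L0 //.
  by apply/funext => p; rewrite /psi; case: ifP.
- rewrite -(bar_delta_piK z) -(bar_delta_piK z') -bar_delta_pi_linear !L'E //.
  exact: Llin (psiS _ _ Tphi) _ _ _.
- rewrite -(bar_delta_piK z) bar_delta_pi_nat !L'E ?Lnat ?psi_comp //.
    exact: psiS.
  by move=> p q Tpq; apply: Tphi; rewrite -raddfB; apply: smem_amap.
(* The class of a preimage of the pair [(m0, m)] realizes evaluation at [m]. *)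
- have [v Lv] := Lsurj _ (amap M (inj1 x a) m0 + amap M (inj2 x a) m).
  exists (bar_delta_pi v) => phi Tphi; rewrite L'E // Lv; last exact: psiS.
  rewrite /psi !raddfD /= -!amapM prj1_inj1 prj1_inj2 prj2_inj1 prj2_inj2.
  rewrite !amap_0l !amap1 addr0 add0r subrr.
  by case: asboolP => // -[]; apply: smem0.
Qed.

Lemma detected_foldr F S n : detected F S -> has_chain S n ->
  exists s : seq A, size s = n /\ ~ fzero (foldr (@bar_delta A k) F s).
Proof.
elim: n F S => [|n IHn] F S FS.
  by exists [::]; split=> //; apply: detected_nonzero FS.
case=> T [ST [x [m [Tm nSm]]] Tn].
have [s [<- sF]] := IHn _ _ (detected_bar_delta ST Tm nSm FS) Tn.
(* The lowest inclusion of the chain feeds the innermost [bar_delta], so its object comes last in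
   the sequence. *)
by exists (rcons s x); rewrite size_rcons foldr_rcons.
Qed.

(** The epimorphism is induced by the second projection, and [inj2] provides preimages. *)
Lemma detected_tau_klin x S : detected (tau x (klin k M)) S.
Proof.
pose L a (phi : M a -> k) (v : {freeg (M (x (+) a)%cat) / k}) : k^o :=
  fglift ((phi \o amap M (prj2 x a)) : M (x (+) a)%cat -> k^o) v.
have Llin a phi : linear (L a phi) by exact: fglift_linear.
have LU a phi c p : L a phi << c *g p >> = c * phi (amap M (prj2 x a) p).
  by rewrite /L liftU.
exists L; split=> [a v|a phi _ |a b f phi v _|a m].
- rewrite -(freeg_sumE v) (linear_fun_sum (Llin _ _)) big1 // => p _.
  by rewrite LU mulr0.
- exact: Llin.
- rewrite -(freeg_sumE v).
  rewrite (linear_fun_sum (@fmap_linear _ _ (tau x (klin k M)) _ _ f)).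
  rewrite !(linear_fun_sum (Llin _ _)); apply: eq_bigr => p _.
  by rewrite [fmap _ _ _]klin_mapU !LU /= -!amapM prj2_sum_map.
- exists << amap M (inj2 x a) m >> => phi _.
  by rewrite LU mul1r -amapM prj2_inj2 amap1.
Qed.

End Detected.

Theorem proposition8p4 (k : fieldType) (A : additiveCategory)
    (hA : essentially_small A) (M : addFunctor A) (d : int)
    (hd : (-1 <= d)%R) :
  in_Fd d (klin k M) <-> (ell M <= d%:E)%E.
Proof.
have [n nd] : exists n : nat, n%:Z = d + 1.
  by exists (absz (d + 1)); rewrite gez0_abs // -lerBlDr sub0r.
rewrite (ell_le M nd); split=> [Fd Mn|Mn x s].
  (* Every object [x] detects the chain; the zero object is one choice. *)
  have [s [sn]] := detected_foldr (detected_tau_klin k (zero_ob A) _) Mn.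
  by apply; apply: Fd; rewrite sn.
rewrite -nd => -[sn]; apply: spanned0; apply: spanned_foldr.
by rewrite addn0 sn; apply: spanned_tau_klin.
Qed.
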